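(* Let $S$ be a simple Hausdorff topological semigroup. If $S$ is sequentially compact or the power $S^{2^{\mathfrak c}}$ is countably compact, then $S$ is a topological paragroup.
   Context: All topological spaces are Hausdorff and all semigroups are nonempty. A topological semigroup is a topological space with a jointly continuous associative binary operation. A semigroup $S$ is simple if it contains no proper (nonempty) two-sided ideal. A space is countably compact if each of its closed discrete subspaces is finite, and sequentially compact if each sequence in it has a convergent subsequence. $\mathfrak c$ is the cardinality of the continuum, and $S^{2^{\mathfrak c}}$ is the Tychonoff product of $2^{\mathfrak c}$ copies of $S$. For a group $H$, sets $X,Y$ and a map $\sigma:Y\times X\to H$, the Rees product $[X,H,Y]_\sigma$ is the set $X\times H\times Y$ with the operation $(x,h,y)\cdot(x',h',y')=(x,h\,\sigma(y,x')\,h',y')$. A topological paragroup is a topological semigroup that is topologically isomorphic (isomorphic via a homeomorphism) to a Rees product $[X,H,Y]_\sigma$ with the product topology, where $X,Y$ are topological spaces, $H$ is a topological group (multiplication and inversion continuous) and $\sigma:Y\times X\to H$ is continuous. *)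

(* Defs.v *)
From HB Require Import structures.
From mathcomp Require Import all_boot all_order all_algebra.
From mathcomp Require Import all_classical all_reals all_analysis.

Set Implicit Arguments.
Unset Strict Implicit.
Unset Printing Implicit Defensive.

Local Open Scope classical_set_scope.
Local Open Scope group_scope.

(* Hausdorffness is not part of these structures: it is required separately,
   by [hausdorff_space], wherever a space occurs. *)
HB.mixin Record isContinuousMul S of Semigroup S & Topological S := {
  mulg_continuous : continuous (fun p : (S * S)%type => p.1 * p.2 : S)
}.

#[short(type="topologicalSemigroupType")]
HB.structure Definition TopologicalSemigroup :=
  {S of Semigroup S & Topological S & isContinuousMul S}.

HB.mixin Record isContinuousInv H of Group H & Topological H := {
  invg_continuous : continuous (fun x : H => x^-1 : H)
}.

#[short(type="topologicalGroupType")]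
HB.structure Definition TopologicalGroup :=
  {H of Group H & TopologicalSemigroup H & isContinuousInv H}.

Definition two_sided_ideal (S : semigroupType) (I : set S) :=
  I !=set0 /\ forall s x : S, I x -> I (s * x) /\ I (x * s).

Definition simple_semigroup (S : semigroupType) :=
  forall I : set S, two_sided_ideal I -> I = [set: S].

(* [A] is coerced to the subtype [set_type A], which carries the subspace
   topology; the equation is the axiom [nbhs_principalE] of
   [discreteTopologicalType]. *)
Definition discrete_subspace (T : topologicalType) (A : set T) :=
  @nbhs A A = principal_filter.

Definition countably_compact_space (T : topologicalType) :=
  forall A : set T, closed A -> discrete_subspace A -> finite_set A.

Definition sequentially_compact_space (T : topologicalType) :=
  forall u : nat -> T, exists (f : nat -> nat) (l : T),
    increasing_seq f /\ u \o f @ \oo --> l.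

(* The index type has cardinality 2^c, since [set nat] has cardinality c. *)
Definition power_two_continuum (T : topologicalType) : topologicalType :=
  {ptws set (set nat) -> T}.

(* A copy of [X * H * Y], so that the Rees multiplication does not clash with
   the componentwise one. *)
Definition rees_product (X Y H : Type) (sigma : Y * X -> H) : Type :=
  (X * H * Y)%type.

HB.instance Definition _ (X Y H : choiceType) (sigma : Y * X -> H) :=
  Choice.copy (rees_product sigma) (X * H * Y)%type.

Section ReesSemigroup.
Variables (X Y : choiceType) (H : groupType) (sigma : Y * X -> H).

Definition rees_mul (a b : rees_product sigma) : rees_product sigma :=
  let: (x, h, y) := a in
  let: (x', h', y') := b in
  (x, h * sigma (y, x') * h', y').

Lemma rees_mulA : associative rees_mul.
Proof. by case=> [[x h] y] [[x' h'] y'] [[x'' h''] y'']; rewrite /= !mulgA. Qed.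

HB.instance Definition _ := isSemigroup.Build (rees_product sigma) rees_mulA.

End ReesSemigroup.

HB.instance Definition _ (X Y H : topologicalType) (sigma : Y * X -> H) :=
  Topological.copy (rees_product sigma) (X * H * Y)%type.

Definition topological_paragroup (S : topologicalSemigroupType) :=
  exists (X Y : topologicalType) (H : topologicalGroupType)
         (sigma : Y * X -> H)
         (f : S -> rees_product sigma) (g : rees_product sigma -> S),
    [/\ hausdorff_space X, hausdorff_space Y & hausdorff_space H] /\
    continuous sigma /\
    {morph f : x y / x * y} /\
    [/\ cancel f g, cancel g f, continuous f & continuous g].

(* Main.v *)
From HB Require Import structures.
Require Import Defs.
From mathcomp Require Import all_boot all_order all_algebra.
From mathcomp Require Import all_classical all_reals all_analysis.

Set Implicit Arguments.
Unset Strict Implicit.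
Unset Printing Implicit Defensive.

Local Open Scope classical_set_scope.
Local Open Scope group_scope.

(** Both compactness hypotheses give a family of free filters on [nat] in which
    every member has, for each sequence of [S], a finer member along which the
    sequence converges: the images of [\oo] under increasing maps if [S] is
    sequentially compact, one suitable ultrafilter if [S^(2^c)] is countably
    compact (Ginsburg and Saks).  Limits along such filters replace compactness.

    Let [T] be the least limit-closed subsemigroup containing [a].  It is
    commutative, the intersection [I] of the [a^n T] is not empty, and the
    [t] with [t I = I] form a limit-closed subsemigroup containing [a].  So
    [t I = I] for all [t] in [T], and [I] is a group.

    If [e] is an idempotent of the simple semigroup [S] and [b] is right
    invertible in [eSe], the right invertible elements of [eSe] form a
    limit-closed subsemigroup; the idempotent multiple of [b] it contains can
    only be [e], so [b] is invertible.  Hence [eSe] is a group.  If inversion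
    were not continuous at [e], there would be neighbourhoods [V_n] with
    [V_(n+1) V_(n+1)] inside [V_n] and points [x_n] of [V_n] whose inverses
    avoid [V_0].  A limit [x] of the [x_n] lies in the intersection of the [V_n],
    which is a limit-closed subsemigroup, so it contains the inverse of [x]: a
    contradiction.  The isomorphism is then
    [s |-> (s h^-1, h, h^-1 s)] with [h = e s e]. *)

(** * Limits along free filters *)

Definition free_filters (FF : set (set_system nat)) :=
  forall F, FF F -> ProperFilter F /\ \oo `<=` F.

(** The new filter refines the given one, so several sequences can be made to converge one after
    another while earlier limits persist. *)
Definition limit_compact (FF : set (set_system nat)) (T : topologicalType) :=
  forall F (u : nat -> T), FF F ->
  exists G (l : T), [/\ FF G, F `<=` G & u @ G --> l].

Definition limit_closed (FF : set (set_system nat)) (T : topologicalType)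
    (A : set T) :=
  forall F (u : nat -> T) (l : T),
    FF F -> (forall n, A (u n)) -> u @ F --> l -> A l.

Definition mul_closed (S : semigroupType) (A : set S) :=
  forall x y, A x -> A y -> A (x * y).

(** For an idempotent [e] this is eSe; as a set of solutions of equations it is visibly
    limit-closed. *)
Definition local_submonoid (S : semigroupType) (e : S) : set S :=
  [set s | e * s = s /\ s * e = s].

Lemma cvg_finer (T : topologicalType) (F G : set_system nat) (u : nat -> T)
    (l : T) :
  F `<=` G -> u @ F --> l -> u @ G --> l.
Proof. by move=> FG ul A /ul /FG. Qed.

Lemma cvg_mulg (S : topologicalSemigroupType) (I : Type) (F : set_system I)
    (u v : I -> S) (x y : S) : Filter F ->
  u @ F --> x -> v @ F --> y -> u i * v i @[i --> F] --> x * y.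
Proof.
move=> filterF; apply: (@continuous2_cvg _ _ _ _ _ _ u v (fun a b : S => a * b)).
exact: (@mulg_continuous S (x, y)).
Qed.

Section Idempotents.
Variables (FF : set (set_system nat)) (S : topologicalSemigroupType).
Hypotheses (FF_neq0 : FF !=set0) (FF_free : free_filters FF).
Hypotheses (S_hausdorff : hausdorff_space S) (S_compact : limit_compact FF S).

Lemma limit_unique (F : set_system nat) (u : nat -> S) (x y : S) :
  FF F -> u @ F --> x -> u @ F --> y -> x = y.
Proof. by move=> /FF_free[PF _]; exact: cvg_unique. Qed.

Lemma limit_const (F : set_system nat) (x y : S) :
  FF F -> (fun=> x) @ F --> y -> y = x.
Proof.
move=> FFF /limit_unique; apply => //.
by have [PF _] := FF_free FFF; exact: cvg_cst.
Qed.

Lemma limit_closedI (A B : set S) :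
  limit_closed FF A -> limit_closed FF B -> limit_closed FF (A `&` B).
Proof.
move=> Ac Bc F u l FFF uAB ul; split.
- by apply: Ac FFF _ ul => n; case: (uAB n).
- by apply: Bc FFF _ ul => n; case: (uAB n).
Qed.

Lemma limit_closed_commutant (t : S) : limit_closed FF [set y | t * y = y * t].
Proof.
move=> F u l FFF /= tu ul; have [PF _] := FF_free FFF.
apply: limit_unique (FFF) _ _.
- exact: cvg_mulg (cvg_cst t) ul.
- rewrite (_ : (fun n => t * u n) = (fun n => u n * t)); last exact/funext.
  exact: cvg_mulg ul (cvg_cst t).
Qed.

(** Along a finer filter the chosen cofactors converge too, and the product of the two limits is
    [x]. *)
Lemma limit_closed_right_divisors (A : set S) (x : S) : limit_closed FF A ->
  limit_closed FF [set t | exists2 r, A r & t * r = x].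
Proof.
move=> Ac F u l FFF /= uA ul.
pose r n : S := sval (cid2 (uA n)).
have rA n : A (r n) by rewrite /r; case: cid2.
have ur n : u n * r n = x by rewrite /r; case: cid2.
have [G [m [FFG FG rm]]] := S_compact r FFF; have [PG _] := FF_free FFG.
exists m; first exact: Ac FFG rA rm.
apply: limit_const (FFG) _.
rewrite (_ : (fun=> x) = (fun n => u n * r n)); last exact/funext.
exact: cvg_mulg (cvg_finer FG ul) rm.
Qed.

(** * Idempotents in monothetic subsemigroups *)

Section Monothetic.
Variable a : S.

(** The least limit-closed subsemigroup containing [a], in a form that makes membership an induction
    principle. *)
Let hull : set S := [set y | forall P : set S,
  limit_closed FF P -> mul_closed P -> P a -> P y].

(* The least ideal of [hull]. *)
Let core : set S :=
  [set y | forall k, exists2 t, hull t & y = iter k (monoid.mul a) t].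

Let hull_closed : limit_closed FF hull.
Proof.
move=> F u l FFF uh ul P Pc Pm Pa; apply: (Pc F u l FFF _ ul) => n.
exact: (uh n P).
Qed.

Let hullM : mul_closed hull.
Proof.
move=> x y hx hy P Pc Pm Pa.
exact: (Pm _ _ (hx P Pc Pm Pa) (hy P Pc Pm Pa)).
Qed.

Let hull_gen : hull a.
Proof. by []. Qed.

Let hull_iter k t : hull t -> hull (iter k (monoid.mul a) t).
Proof. by move=> ht; elim: k => //= k IH; exact: hullM. Qed.

Let commutantM t : mul_closed [set y : S | t * y = y * t].
Proof. by move=> x y /= tx ty; rewrite mulgA tx -mulgA ty mulgA. Qed.

(** The commutant of an element is a limit-closed subsemigroup. Induct over [hull] twice: first
    against [a], then against any element of [hull]. *)
Let hullC x y : hull x -> hull y -> x * y = y * x.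
Proof.
move=> hx hy.
have hullE t z : t * a = a * t -> hull z -> t * z = z * t.
  by move=> ta /(_ _ (@limit_closed_commutant t) (@commutantM t) ta).
by apply: (hullE) => //; apply: esym; exact: (hullE a).
Qed.

Let iter_mulC k t x : hull t ->
  t * iter k (monoid.mul a) x = iter k (monoid.mul a) (t * x).
Proof.
move=> ht; elim: k => //= k IH.
by rewrite mulgA (hullC ht hull_gen) -mulgA IH.
Qed.

Let cvg_iter k (F : set_system nat) (u : nat -> S) (l : S) : ProperFilter F ->
  u @ F --> l ->
  (fun n => iter k (monoid.mul a) (u n)) @ F --> iter k (monoid.mul a) l.
Proof.
by move=> PF ul; elim: k => //= k IH; exact: cvg_mulg (cvg_cst a) IH.
Qed.

(** For each k the cofactors t_n converge along a finer filter to some m, whence l = a^k m. For n <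
    k an arbitrary element of [hull] is taken, which a free filter does not see. *)
Let core_tail F (u : nat -> S) (l : S) : FF F -> u @ F --> l ->
  (forall k n, k <= n -> exists2 t, hull t & u n = iter k (monoid.mul a) t) ->
  core l.
Proof.
move=> FFF ul uP k.
have /choice[t tP] : forall n, exists t,
    hull t /\ (k <= n -> u n = iter k (monoid.mul a) t).
  move=> n; have [/uP[t ht ->]|_] := leqP k n; first by exists t.
  by exists a.
have [G [m [FFG FG tm]]] := S_compact t FFF; have [PG ooG] := FF_free FFG.
exists m; first by apply: hull_closed FFG _ tm => n; case: (tP n).
apply: limit_unique (FFG) (cvg_finer FG ul) _.
apply: cvg_trans (cvg_iter (k := k) PG tm); apply: near_eq_cvg.
by apply: ooG; exists k => // n /= kn; have [_ ->] := tP n.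
Qed.

Let core_closed : limit_closed FF core.
Proof.
move=> F u l FFF uc ul; apply: core_tail FFF ul _ => k n _; exact: uc.
Qed.

Let core_hull y : core y -> hull y.
Proof. by move=> /(_ 0)[t ht ->]. Qed.

Let coreM t y : hull t -> core y -> core (t * y).
Proof.
move=> ht cy k; have [s hs ->] := cy k.
by exists (t * s); [exact: hullM | rewrite iter_mulC].
Qed.

Let core_neq0 : core !=set0.
Proof.
have [F FFF] := FF_neq0.
have [G [l [FFG _ ul]]] := S_compact (fun n => iter n (monoid.mul a) a) FFF.
exists l; apply: core_tail FFG ul _ => k n kn.
  exists (iter (n - k) (monoid.mul a) a).
  exact: hull_iter.
by rewrite -iterD subnKC.
Qed.

(** The [t] with this property form a limit-closed subsemigroup [D] containing [a], so induction
    over [hull] applies. *)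
Let core_divisible y t : hull t -> core y -> exists2 z, core z & t * z = y.
Proof.
move=> ht; move: y.
pose D := [set t | forall y, core y -> exists2 z, core z & t * z = y].
apply: (ht D) => [F u l FFF uD ul y cy| p q Dp Dq y cy |y cy].
- have := limit_closed_right_divisors core_closed.
  by move=> /(_ y F u l FFF)/(_ (fun n => uD n y cy) ul).
- have [z cz <-] := Dp _ cy; have [w cw <-] := Dq _ cz.
  by exists w; rewrite ?mulgA.
(* The exponent n+1 sets one factor [a] apart: a limit of the a^n s_n lies in [core], and [a] times
   it is [y]. *)
- have /choice[s sP] : forall n, exists s,
      hull s /\ y = iter n.+1 (monoid.mul a) s.
    by move=> n; have [s] := cy n.+1; exists s.
  have [F FFF] := FF_neq0.
  have [G [l [FFG FG ul]]] :=
    S_compact (fun n => iter n (monoid.mul a) (s n)) FFF.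
  have [PG _] := FF_free FFG.
  exists l.
    apply: core_tail FFG ul _ => k n kn.
    exists (iter (n - k) (monoid.mul a) (s n)).
      by apply: hull_iter; case: (sP n).
    by rewrite -iterD subnKC.
  apply: limit_const (FFG) _.
  rewrite (_ : (fun=> y) = (fun n => a * iter n (monoid.mul a) (s n))).
    exact: cvg_mulg (cvg_cst a) ul.
  by apply: funext => n; have [_] := sP n.
Qed.

Lemma idempotent_multiple (R : set S) : limit_closed FF R -> mul_closed R ->
  R a -> exists u t, [/\ R u, R t, u * u = u, a * t = u & t * a = u].
Proof.
move=> Rc Rm Ra; have hR y : hull y -> R y by move=> hy; exact: hy.
have [z cz] := core_neq0.
(* By commutativity [u], a unit for [z], is also one for every multiple of [z], in particular for z
   w = u; so u u = u. *)
have [u cu zu] := core_divisible (core_hull cz) cz.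
have [w cw zw] := core_divisible (core_hull cz) cu.
have [t ct at_] := core_divisible hull_gen cu.
exists u, t; split=> //.
- exact: hR (core_hull cu).
- exact: hR (core_hull ct).
- by rewrite -{2}zw mulgA (hullC (core_hull cu) (core_hull cz)) zu.
- by rewrite (hullC (core_hull ct) hull_gen).
Qed.

End Monothetic.

Lemma exists_idempotent : [set: S] !=set0 -> exists e : S, e * e = e.
Proof.
case=> a _; have [] := @idempotent_multiple a setT; first by [].
- by [].
- by [].
- by move=> u [_ [_ _ uu _ _]]; exists u.
Qed.

(** * The groups eSe of a simple semigroup *)

Lemma limit_closed_local_submonoid (e : S) :
  limit_closed FF (local_submonoid e).
Proof.
move=> F u l FFF ue ul; have [PF _] := FF_free FFF.
have eu : (fun n => e * u n) = u by apply: funext => n; have [] := ue n.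
have ue' : (fun n => u n * e) = u by apply: funext => n; have [] := ue n.
split; apply: limit_unique (FFF) _ (ul).
- by rewrite -{1}eu; exact: cvg_mulg (cvg_cst e) ul.
- by rewrite -{1}ue'; exact: cvg_mulg ul (cvg_cst e).
Qed.

(** The products s x t form a two-sided ideal, which is everything by simplicity. *)
Lemma simple_factor (x y : S) : simple_semigroup S ->
  exists s t, y = s * x * t.
Proof.
move=> simp.
suff : [set y | exists s t, y = s * x * t] = setT by move/seteqP=> [_]; apply.
apply: simp; split=> [|z _ [s [t ->]]]; first by exists (x * x * x), x, x.
split; first by exists (z * s), t; rewrite !mulgA.
by exists s, (t * z); rewrite !mulgA.
Qed.

Section LocalGroup.
Variable e : S.
Hypotheses (ee : e * e = e) (S_simple : simple_semigroup S).
Let M : set S := local_submonoid e.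

Let MM : mul_closed M.
Proof.
by move=> x y [ex xe] [ey ye]; split; rewrite ?mulgA ?ex // -mulgA ye.
Qed.

Let right_invertible_invertible b c : M b -> M c -> b * c = e ->
  exists2 t, M t & b * t = e /\ t * b = e.
Proof.
move=> Mb Mc bc.
pose R := M `&` [set t | exists2 r, M r & t * r = e].
have Rc : limit_closed FF R.
  apply: limit_closedI; first exact: limit_closed_local_submonoid.
  exact/limit_closed_right_divisors/limit_closed_local_submonoid.
have Rm : mul_closed R.
  move=> x y [Mx [r Mr xr]] [My [s Ms ys]]; split; first exact: MM.
  exists (s * r); first exact: MM.
  by rewrite -mulgA (mulgA y) ys (proj1 Mr).
have Rb : R b by split=> //; exists c.
have [u [t [[Mu [r Mr ur]] [Mt _] uu bt tb]]] := idempotent_multiple Rc Rm Rb.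
(* An idempotent with a right inverse r is the unit: u = u (u r) = u r = e. *)
have ue : u = e by rewrite -(proj2 Mu) -{1}ur mulgA uu.
by exists t; rewrite // bt tb.
Qed.

Lemma local_group s : M s -> exists2 t, M t & s * t = e /\ t * s = e.
Proof.
move=> Ms; have [x' [y' exy]] := simple_factor s e S_simple.
(* Compressing the factors of e = x' s y' into eSe keeps the product, as [s] absorbs [e] on both
   sides. *)
pose x := e * x' * e; pose y := e * y' * e.
have Mc z : M (e * z * e) by split; [rewrite !mulgA ee | rewrite -!mulgA ee].
have xsy : x * s * y = e.
  rewrite /x /y !mulgA -(mulgA _ e s) (proj1 Ms) -(mulgA _ s e) (proj2 Ms).
  by rewrite -(mulgA e x') -(mulgA e) -exy ee.
have Mx : M x by exact: Mc.
have My : M y by exact: Mc.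
have [p Mp [_ px]] : exists2 p, M p & x * p = e /\ p * x = e.
  by apply: (right_invertible_invertible Mx (MM Ms My)); rewrite mulgA.
apply: (right_invertible_invertible Ms (MM My Mx)).
(* From p x = e and x s y = e one gets s y = p, hence s y x = e. *)
rewrite mulgA -(proj1 (MM Ms My)) -{1}px -(mulgA p) (mulgA x) xsy.
by rewrite (proj2 Mp) px.
Qed.

(** * Continuity of inversion in eSe *)

Section Inverse.
Variable inv : S -> S.
Hypothesis invP : forall s, M s -> [/\ M (inv s), s * inv s = e & inv s * s = e].

Let inv_unique s t : M s -> M t -> s * t = e -> inv s = t.
Proof.
by move=> Ms Mt st; have [Ms' _ s's] := invP Ms;
  rewrite -(proj2 Ms') -st mulgA s's (proj1 Mt).
Qed.

(** Once the inverses converge along a finer filter, u_n inv(u_n) = e passes to the limit and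
    identifies their limit. *)
Let inv_limit F (u : nat -> S) (l : S) : FF F -> (forall n, M (u n)) ->
  u @ F --> l -> exists G, [/\ FF G, F `<=` G & inv (u n) @[n --> G] --> inv l].
Proof.
move=> FFF Mu ul; have [G [m [FFG FG vm]]] := S_compact (inv \o u) FFF.
have [PG _] := FF_free FFG.
have Ml : M l.
    exact: (@limit_closed_local_submonoid e F u l FFF Mu ul).
have Mm : M m.
  apply: (@limit_closed_local_submonoid e G _ m FFG _ vm) => n.
  by have [] := invP (Mu n).
exists G; split=> //; rewrite (inv_unique Ml Mm) //.
apply: limit_const (FFG) _.
rewrite (_ : (fun=> e) = (fun n => u n * inv (u n))).
  exact: cvg_mulg (cvg_finer FG ul) vm.
by apply: funext => n; have [] := invP (Mu n).
Qed.

Let inv_cvg1 (U : set S) : open U -> U e ->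
  exists2 V : set S, nbhs e V & forall s, M s -> V s -> U (inv s).
Proof.
move=> Uo Ue; apply: contrapT => noV.
(* Posed for every set [V], so that choice gives a total map [W] that can be iterated from [U]. *)
have sqr (V : set S) : exists W : set S,
    nbhs e V -> nbhs e W /\ forall x y, W x -> W y -> V (x * y).
  have [eV|eV] := pselect (nbhs e V); last by exists V.
  have : nbhs (e, e) ((fun p : S * S => p.1 * p.2) @^-1` V).
    by apply: (@mulg_continuous S (e, e)); rewrite /= ee.
  move=> [[A B] /= [eA eB] AB]; exists (A `&` B) => _.
  split; first exact: filterI.
  by move=> x y [Ax _] [_ By]; apply: (AB (x, y)).
have [W WP] := choice sqr; pose V n := iter n W U.
have eV n : nbhs e (V n).
  by elim: n => [|n /WP[]//]; exact: open_nbhs_nbhs.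
have VM n x y : V n.+1 x -> V n.+1 y -> V n (x * y).
  by have [_] := WP _ (eV n); apply.
have VS n s : M s -> V n.+1 s -> V n s.
  by move=> [_ se] Vs; rewrite -se; exact: VM Vs (nbhs_singleton (eV n.+1)).
have Vle m n s : m <= n -> M s -> V n s -> V m s.
  move=> mn Ms; rewrite -(subnK mn); elim: (n - m) => // k IH.
  by move=> /VS-/(_ Ms)/IH.
pose N := [set s | M s /\ forall n, V n s].
have NM : mul_closed N.
  by move=> x y [Mx Vx] [My Vy]; split=> [|n]; [exact: MM | exact: VM].
have N_limit F (u : nat -> S) (l : S) : FF F -> (forall n, M (u n)) ->
    (forall n, V n (u n)) -> u @ F --> l -> N l.
  move=> FFF Mu Vu ul; have Ml : M l.
    exact: (@limit_closed_local_submonoid e F u l FFF Mu ul).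
  split=> // k; have [G [FFG FG vl]] := inv_limit FFF Mu ul.
  have [PG ooG] := FF_free FFG; have [Ml' _ l'l] := invP Ml.
  (* Write l = u_n (inv(u_n) l). For suitable n > k both factors lie in V_(k+1), so [l] lies in
     V_k. *)
  have vle : inv (u n) * l @[n --> G] --> e.
    by rewrite -l'l; exact: cvg_mulg vl (cvg_cst l).
  have Gk : G [set n | k < n] by apply: ooG; exists k.+1.
  have [n [/= Vn kn]] := filter_ex (@filterI _ G PG _ _ (vle _ (eV k.+1)) Gk).
  have [_ uu' _] := invP (Mu n).
  rewrite -(proj1 Ml) -uu' -mulgA; apply: VM => //.
  exact: Vle kn (Mu n) (Vu n).
have Nc : limit_closed FF N.
  move=> F u l FFF Nu; apply: N_limit => // n; first by case: (Nu n).
  by have [_] := Nu n; apply.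
have [x xP] : exists x : nat -> S,
    forall n, [/\ M (x n), V n (x n) & ~ U (inv (x n))].
  suff /choice[x xP] : forall n, exists s, [/\ M s, V n s & ~ U (inv s)].
    by exists x.
  move=> n; apply: contrapT => nos; apply: noV; exists (V n) => // s Ms Vs.
  by apply: contrapT => nU; apply: nos; exists s.
have Mx n : M (x n) by case: (xP n).
have [F FFF] := FF_neq0.
have [G [l [FFG _ xl]]] := S_compact x FFF.
have Nl : N l by apply: N_limit FFG Mx _ xl => n; case: (xP n).
(* The idempotent multiple of [l] is [e], so inv(l) = t lies in [N], hence in V_0 = U. But it is a
   limit of the inv(x_n), all outside the open set [U]. *)
have [u [t [[Mu _] [Mt Vt] uu lt _]]] := idempotent_multiple Nc NM Nl.
have ue : u = e.
  by have [_ uu' _] := invP Mu; rewrite -(proj2 Mu) -uu' mulgA uu.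
have [K [FFK _ vt]] := inv_limit FFG Mx xl.
have [PK _] := FF_free FFK.
have Ut : nbhs (inv l) U.
  by apply: open_nbhs_nbhs; split=> //; rewrite (inv_unique (proj1 Nl) Mt) ?lt //;
    exact: (Vt 0).
by have [n] := @filter_ex _ K PK _ (vt _ Ut); case: (xP n).
Qed.

(** Translation to the unit: inv(s) = inv(inv(a) s) inv(a), and inv(a) s tends to [e] as [s] tends
    to [a]. *)
Lemma local_inverse_continuous a : M a -> inv @ within M (nbhs a) --> inv a.
Proof.
move=> Ma U Ua; have [Ma' aa' a'a] := invP Ma.
have : nbhs e ((fun s => s * inv a) @^-1` U).
  have : s * inv a @[s --> e] --> e * inv a.
    exact: cvg_mulg (cvg_id) (cvg_cst _).
  by apply; rewrite (proj1 Ma').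
rewrite nbhsE => -[U' [U'o U'e] U'U].
have [V eV VP] := inv_cvg1 U'o U'e.
have : nbhs a ((fun s => inv a * s) @^-1` V).
  have : inv a * s @[s --> a] --> inv a * a.
    exact: cvg_mulg (cvg_cst _) (cvg_id).
  by apply; rewrite a'a.
rewrite /= /within /=; apply: filterS => s Vs Ms.
have Mas : M (inv a * s) by exact: MM.
have [Mc asc _] := invP Mas.
suff e1 : inv s = inv (inv a * s) * inv a.
  by rewrite /= e1; exact: U'U (VP _ Mas Vs).
apply: inv_unique => //; first exact: MM.
rewrite mulgA (_ : s * inv (inv a * s) = a) //.
by rewrite -{1}(proj1 Ms) -aa' -!mulgA (mulgA (inv a)) asc (proj2 Ma).
Qed.

End Inverse.
End LocalGroup.
End Idempotents.

(** * Subspaces, and eSe as a topological group *)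

Lemma subtype_continuous_val (T : topologicalType) (A : set T) :
  continuous (val : A -> T).
Proof. exact: initial_continuous. Qed.

Lemma subtype_continuous (X T : topologicalType) (A : set T) (f : X -> A) :
  continuous (fun x => val (f x)) -> continuous f.
Proof. exact: continuous_comp_initial. Qed.

Lemma subtype_hausdorff (T : topologicalType) (A : set T) :
  hausdorff_space T -> hausdorff_space A.
Proof.
move=> hT p q pq; apply/val_inj/hT => U V Up Vq.
have [|x [Ux Vx]] := pq (val @^-1` U) (val @^-1` V) _ (subtype_continuous_val Vq).
  exact: (subtype_continuous_val Up).
by exists (val x).
Qed.

(** Since [inv] is a total function on [S] with prescribed values only on eSe, its continuity is
    relative to eSe. *)
Definition local_topological_group (S : topologicalSemigroupType) (e : S)
    (inv : S -> S) :=
  [/\ e * e = e, forall s, local_submonoid e s ->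
        [/\ local_submonoid e (inv s), s * inv s = e & inv s * s = e] &
      forall a, local_submonoid e a ->
        inv @ within (local_submonoid e) (nbhs a) --> inv a].

Section LocalGroupType.
Variables (S : topologicalSemigroupType) (e : S) (inv : S -> S).
Hypothesis eP : local_topological_group e inv.

(* The unused proof argument is what the group instances below are inferred
   from. *)
Definition local_group_type of local_topological_group e inv : Type :=
  set_type (local_submonoid e).
Local Notation H := (local_group_type eP).

HB.instance Definition _ :=
  Topological.copy H (set_type (local_submonoid e)).

Definition local_val (x : H) : S := val (x : set_type (local_submonoid e)).

Lemma local_valP x :
  e * local_val x = local_val x /\ local_val x * e = local_val x.
Proof. exact: (set_mem (valP (x : set_type (local_submonoid e)))). Qed.

Lemma local_mul_subproof (x y : H) :
  local_val x * local_val y \in local_submonoid e.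
Proof.
have [[ex _] [_ ye]] := (local_valP x, local_valP y).
by apply/mem_set; split; rewrite ?mulgA ?ex // -mulgA ye.
Qed.

Lemma local_one_subproof : e \in local_submonoid e.
Proof. by apply/mem_set; case: eP => ee _ _; split. Qed.

Lemma local_inv_subproof (x : H) : inv (local_val x) \in local_submonoid e.
Proof. by apply/mem_set; case: eP => _ /(_ _ (local_valP x))[]. Qed.

Definition local_mul (x y : H) : H :=
  exist (fun s => s \in local_submonoid e) _ (local_mul_subproof x y).
Definition local_one : H :=
  exist (fun s => s \in local_submonoid e) _ local_one_subproof.
Definition local_inv (x : H) : H :=
  exist (fun s => s \in local_submonoid e) _ (local_inv_subproof x).

Lemma local_val_inj : injective local_val. Proof. exact: val_inj. Qed.

Lemma local_mulA : associative local_mul.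
Proof. by move=> x y z; apply: local_val_inj; exact: mulgA. Qed.

Lemma local_mul1g : left_id local_one local_mul.
Proof. by move=> x; apply: local_val_inj; case: (local_valP x). Qed.

Lemma local_mulg1 : right_id local_one local_mul.
Proof. by move=> x; apply: local_val_inj; case: (local_valP x). Qed.

Lemma local_mulVg : left_inverse local_one local_inv local_mul.
Proof.
by move=> x; apply: local_val_inj; case: eP => _ /(_ _ (local_valP x))[].
Qed.

Lemma local_mulgV : right_inverse local_one local_inv local_mul.
Proof.
by move=> x; apply: local_val_inj; case: eP => _ /(_ _ (local_valP x))[].
Qed.

HB.instance Definition _ := isGroup.Build H
  local_mulA local_mul1g local_mulg1 local_mulVg local_mulgV.

Lemma local_val_continuous : continuous local_val.
Proof. exact: subtype_continuous_val. Qed.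

Lemma local_mul_continuous : continuous (fun p : (H * H)%type => p.1 * p.2 : H).
Proof.
apply: (@subtype_continuous (H * H)%type S (local_submonoid e)) => -[x y].
apply: (@cvg_mulg S (H * H)%type _ (fun p => local_val p.1)
  (fun p => local_val p.2) (local_val x) (local_val y)).
- apply: (@continuous_comp _ _ _ fst local_val (x, y)); first exact: cvg_fst.
  exact: local_val_continuous.
- apply: (@continuous_comp _ _ _ snd local_val (x, y)); first exact: cvg_snd.
  exact: local_val_continuous.
Qed.

HB.instance Definition _ := isContinuousMul.Build H local_mul_continuous.

Lemma local_inv_continuous : continuous (fun x : H => x^-1 : H).
Proof.
apply: (@subtype_continuous H S (local_submonoid e)) => x U Ux.
have [_ _ /(_ _ (local_valP x) _ Ux) invU] := eP.
have VU : nbhs x (local_val @^-1` [set s | local_submonoid e s -> U (inv s)]).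
  exact: local_val_continuous invU.
by apply: filterS VU => y; apply; exact: local_valP.
Qed.

HB.instance Definition _ := isContinuousInv.Build H local_inv_continuous.

End LocalGroupType.

(** * The Rees product decomposition *)

Lemma local_topological_group_paragroup (S : topologicalSemigroupType) (e : S)
    (inv : S -> S) : hausdorff_space S -> local_topological_group e inv ->
  (forall s, exists a b, s = a * e * b) -> topological_paragroup S.
Proof.
move=> hS eP SeS; have [ee invP inv_cont] := eP.
(* The elements of [X] and [Y] are idempotents of Se and eS; the products y x lie in eSe and give
   the sandwich map [sigma]. *)
pose X : set S := [set x | x * e = x /\ e * x = e].
pose Y : set S := [set y | e * y = y /\ y * e = e].
pose H : topologicalGroupType := local_group_type eP.
pose v : H -> S := @local_val S e inv eP.
have vP h : e * v h = v h /\ v h * e = v h by exact: local_valP.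
have XP (x : X) : val x * e = val x /\ e * val x = e by exact: (set_mem (valP x)).
have YP (y : Y) : e * val y = val y /\ val y * e = e by exact: (set_mem (valP y)).
have yxP (p : Y * X) : val p.1 * val p.2 \in local_submonoid e.
  have [[ey _] [xe _]] := (YP p.1, XP p.2).
  by apply/mem_set; split; rewrite ?mulgA ?ey // -mulgA xe.
pose sigma (p : Y * X) : H :=
  exist (fun s => s \in local_submonoid e) _ (yxP p).
have eseP s : local_submonoid e (e * s * e).
  by split; [rewrite !mulgA ee | rewrite -!mulgA ee].
pose h (s : S) : S := e * s * e; pose k (s : S) : S := inv (h s).
have kP s : [/\ local_submonoid e (k s), h s * k s = e & k s * h s = e].
  exact: (invP _ (eseP s)).
have hkE s : e * s * k s = e.
  have [[ek _] hk _] := kP s; rewrite -[RHS]hk /h -[in RHS](mulgA _ e) ek //.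
have khE s : k s * s * e = e.
  by have [[_ ke] _ kh] := kP s; rewrite -[RHS]kh /h !mulgA ke.
have XsP s : s * k s \in X.
  apply/mem_set; have [[ek ke] _ _] := kP s; split; first by rewrite -mulgA ke.
  by rewrite mulgA hkE.
have YsP s : k s * s \in Y.
  apply/mem_set; have [[ek ke] _ _] := kP s; split; last exact: khE.
  by rewrite mulgA ek.
have hsP s : h s \in local_submonoid e by exact/mem_set/eseP.
pose f (s : S) : rees_product sigma :=
  ((exist (fun s => s \in X) _ (XsP s) : X,
    exist (fun s => s \in local_submonoid e) _ (hsP s) : H),
   exist (fun s => s \in Y) _ (YsP s) : Y).
pose g (p : rees_product sigma) : S := val p.1.1 * v p.1.2 * val p.2.
have gM : {morph g : p q / p * q}.
  move=> [[x r] y] [[x' r'] y'].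
  change (val x * (v r * (val y * val x') * v r') * val y' =
    (val x * v r * val y) * (val x' * v r' * val y')).
  by rewrite !mulgA.
have hg (x : X) (r : H) (y : Y) : h (val x * v r * val y) = v r.
  have [[[_ ex] [_ ye]] [er re]] := (XP x, YP y, vP r).
  by rewrite /h !mulgA ex er -mulgA ye re.
have gK : cancel g f.
  move=> [[x r] y]; rewrite /g /=; have := hg x r y.
  set s := (_ * _ * _) => hs; have [[ek ke] hk kh] := kP s.
  have [[xe ex] [ey ye]] := (XP x, YP y).
  congr (_, _, _); apply: val_inj; rewrite /= ?hs //.
  - by rewrite {1}/s -ek -!mulgA (mulgA (val y)) ye ek -hs hk xe.
  - by rewrite {2}/s -ke !mulgA -(mulgA _ e) ex ke -hs kh ey.
have fK : cancel f g.
  move=> s; change (s * k s * h s * (k s * s) = s).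
  have [[ek ke] hk kh] := kP s; have [a [b sab]] := SeS s.
  have [[_ ie] aia iaa] := invP _ (eseP a).
  (* With s = a e b, the element e b k(s) is the inverse of e a e. Thus e b k(s) a e = e, and s k(s)
     s = a (e b k(s) a e) b = s. *)
  have am : (e * a * e) * (e * b * k s) = e.
    by rewrite !mulgA -(mulgA _ e e) ee -(mulgA e a) -(mulgA e) -sab hkE.
  have mE : e * b * k s = inv (e * a * e).
    by rewrite -[RHS]ie -[X in _ = _ * X]am mulgA iaa !mulgA ee.
  have bkae : e * b * k s * a * e = e.
    by rewrite mE -{1}ie -(mulgA _ e a) -(mulgA _ (e * a)) iaa.
  rewrite -(mulgA s) kh -mulgA (mulgA e) ek; move: (k s) bkae => c bcae.
  rewrite {}sab; transitivity (a * (e * b * c * a * e) * b).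
    by rewrite !mulgA.
  by rewrite bcae.
have continuousM (T : topologicalType) (u w : T -> S) :
    continuous u -> continuous w -> continuous (fun t => u t * w t).
  by move=> uc wc t; exact: cvg_mulg (uc t) (wc t).
have c_val (T : topologicalType) (A : set S) (u : T -> A) :
    continuous u -> continuous (fun t => val (u t)).
  by move=> uc t; apply: continuous_comp (uc t) _; exact: subtype_continuous_val.
have idc : continuous (fun s : S => s) by move=> s; exact: cvg_id.
have cstc (c : S) : continuous (fun _ : S => c) by move=> s; exact: cvg_cst.
have hc : continuous h.
  apply: (@continuousM S (fun s => e * s) (fun=> e)) => //.
  exact: (@continuousM S (fun=> e) id).
have kc : continuous k.
  move=> s U /(inv_cont _ (eseP s)) invU.
  have VU : nbhs s (h @^-1` [set t | local_submonoid e t -> U (inv t)]).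
    exact: hc invU.
  by apply: filterS VU => t; apply; exact: eseP.
exists X, Y, H, sigma, f, g; split.
  split; [exact: subtype_hausdorff | exact: subtype_hausdorff |].
  exact: (@subtype_hausdorff S (local_submonoid e)).
split.
  apply: (@subtype_continuous _ S (local_submonoid e)).
  apply: continuousM; apply: c_val => p; [exact: cvg_fst | exact: cvg_snd].
split.
  by move=> s t; apply: (can_inj gK); rewrite gM !fK.
split=> //.
  have fc1 : continuous (fun s => (f s).1.1).
    by apply: subtype_continuous; exact: (@continuousM S id k).
  have fc2 : continuous (fun s => (f s).1.2).
    by apply: (@subtype_continuous _ S (local_submonoid e)).
  have fc3 : continuous (fun s => (f s).2).
    by apply: subtype_continuous; exact: (@continuousM S k id).
  by move=> s; apply: (cvg_pair (cvg_pair (fc1 s) (fc2 s)) (fc3 s)).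
have c1 : continuous (fun p : X * H * Y => p.1).
  by move=> p; exact: cvg_fst.
apply: (@continuousM (X * H * Y)%type); first apply: continuousM.
- apply: c_val => p; apply: continuous_comp (c1 p) _; exact: cvg_fst.
- apply: (@c_val _ (local_submonoid e)) => p.
  apply: continuous_comp (c1 p) _; exact: cvg_snd.
- by apply: c_val => p; exact: cvg_snd.
Qed.

(** * From the compactness hypotheses to limits along filters *)

Lemma increasing_seq_cvg (f : nat -> nat) : increasing_seq f -> f @ \oo --> \oo.
Proof.
move=> f_incr; have f_ge n : n <= f n.
  elim: n => // n IH; apply: leq_ltn_trans IH _.
  by have := f_incr n.+1 n; rewrite ltnn leEnat ltnNge => ->.
move=> A [N _ NA]; exists N => // n Nn; apply: NA.
exact: leq_trans Nn (f_ge n).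
Qed.

Lemma sequentially_compact_limit_compact (T : topologicalType) :
  sequentially_compact_space T ->
  exists FF, [/\ FF !=set0, free_filters FF & limit_compact FF T].
Proof.
move=> T_sc.
exists [set F | exists2 f : nat -> nat, increasing_seq f & F = f @ \oo]; split.
- by exists \oo, id.
- move=> _ [f f_incr ->]; split; first exact: fmap_proper_filter.
  exact: increasing_seq_cvg.
- move=> _ u [f f_incr ->]; have [g [l [g_incr ul]]] := T_sc (u \o f).
  exists ((f \o g) @ \oo), l; split=> //.
  + by exists (f \o g) => // m n; exact: etrans (f_incr _ _) (g_incr _ _).
  + by move=> A /= fA; exact: (increasing_seq_cvg g_incr fA).
Qed.

(** Without cluster points, each point has a neighbourhood avoided by a tail of [z]; shrinking it to
    avoid the finitely many other terms shows the range closed and discrete. The range is then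
    finite, hence compact, and [z] clusters after all. *)
Lemma countably_compact_cluster (T : topologicalType) (z : nat -> T) :
  hausdorff_space T -> countably_compact_space T -> cluster (z @ \oo) !=set0.
Proof.
move=> hT T_cc; apply: contrapT => noc.
have isolated (x : T) : nbhs x [set y | range z y -> y = x].
  have [U [Ux [N zU]]] : exists U, nbhs x U /\
      exists N, forall n, N <= n -> ~ U (z n).
    apply: contrapT => noU; apply: noc; exists x => A B [N _ NA] Bx.
    apply: contrapT => AB; apply: noU; exists B; split=> //; exists N => n Nn Bz.
    by apply: AB; exists (z n); split=> //; exact: NA.
  have avoid n : nbhs x [set y | z n = y -> y = x].
    have [->|/eqP zx] := eqVneq (z n) x; first by apply: filterE => y ->.
    have : nbhs x (~` [set z n]).
      apply: open_nbhs_nbhs; split; last exact/nesym.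
      exact/closed_openC/accessible_closed_set1/hausdorff_accessible.
    by apply: filterS => y yz /esym/yz.
  have avoidN : nbhs x [set y | forall n, n < N -> z n = y -> y = x].
    elim: (N) => [|m IH]; first exact: filterE.
    apply: filterS (filterI IH (avoid m)) => y [ym yx] n.
    by rewrite ltnS leq_eqVlt => /orP[/eqP->|/ym].
  apply: filterS (filterI Ux avoidN) => y [Uy yP] [n _ zn].
  have [nN|Nn] := ltnP n N; first exact: yP nN zn.
  by case: (zU n Nn); rewrite zn.
have fin : finite_set (range z).
  apply: T_cc.
    move=> x cx; have [y [ry /(_ ry) <-]] := cx _ (isolated x); exact: ry.
  apply: funext => -[x xA]; rewrite eqEsubset; split=> U.
    by move=> /nbhs_singleton /principal_filterP.
  move=> /principal_filterP Ux.
  have : nbhs (exist _ x xA : range z) (val @^-1` [set y | range z y -> y = x]).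
    exact: (@subtype_continuous_val _ (range z) (exist _ x xA) _ (isolated x)).
  apply: filterS => -[y yA] /= yx.
  suff -> : exist _ y yA = exist (fun s => s \in range z) x xA by [].
  by apply: val_inj => /=; apply: yx; exact: set_mem.
have [|x [_ xc]] := finite_compact fin (F := z @ \oo).
  by exists 0 => // n _; exists n.
by apply: noc; exists x.
Qed.

(** The traces of tails on preimages of neighbourhoods of [l] are nonempty and generate a filter;
    any ultrafilter above it serves. *)
Lemma cluster_free_ultrafilter (T : topologicalType) (z : nat -> T) (l : T) :
  cluster (z @ \oo) l ->
  exists F, [/\ UltraFilter F, \oo `<=` F & z @ F --> l].
Proof.
move=> zl.
pose D := [set P : set nat * set T | \oo P.1 /\ nbhs l P.2].
pose G := filter_from D (fun P => P.1 `&` z @^-1` P.2).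
have PG : ProperFilter G.
  apply: filter_from_proper; last first.
    move=> [A B] [/= ooA lB].
    have [|_ [[n An <-] Bn]] := zl (z @` A) B _ lB; last by exists n.
    by apply: filterS ooA => n An; exists n.
  apply: filter_from_filter; first by exists (setT, setT); split; exact: filterT.
  move=> [A B] [A' B'] [/= ooA lB] [/= ooA' lB'].
  exists (A `&` A', B `&` B'); first by split; exact: filterI.
  by move=> n [[? ?] [? ?]].
have [F [UF GF]] := ultraFilterLemma PG.
exists F; split=> //.
- move=> A ooA; apply: GF; exists (A, setT); last by move=> n [].
  by split=> //; exact: filterT.
- move=> B lB; apply: GF; exists (setT, B); last by move=> n [].
  by split=> //; exact: filterT.
Qed.

(* If no free ultrafilter served for all sequences of [T] at once, choosing a
   counterexample for each of them would give a sequence in a power of [T]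
   indexed by the ultrafilters, and a cluster point of it a contradiction. *)
Lemma power_two_continuum_limit_compact (T : topologicalType) :
  [set: T] !=set0 -> hausdorff_space T ->
  countably_compact_space (power_two_continuum T) ->
  exists FF, [/\ FF !=set0, free_filters FF & limit_compact FF T].
Proof.
move=> [t0 _] hT T_cc.
suff [F [UF ooF Flim]] : exists F : set_system nat, [/\ UltraFilter F,
    \oo `<=` F & forall u : nat -> T, exists l : T, u @ F --> l].
  exists [set F]; split; first by exists F.
    by move=> _ ->; split=> //; exact: ultra_proper.
  by move=> _ u ->; have [l ul] := Flim u; exists F, l; split.
apply: contrapT => noF.
have /choice[u uP] : forall F : set_system nat, exists u : nat -> T,
    UltraFilter F -> \oo `<=` F -> forall l : T, ~ u @ F --> l.
  move=> F; have [[u uP]|nou] :=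
    pselect (exists u : nat -> T, forall l : T, ~ u @ F --> l); first by exists u.
  exists (fun=> t0) => UF ooF; case: noF; exists F; split=> // u.
  by apply: contrapT => nol; apply: nou; exists u => l ul; apply: nol; exists l.
(* Set systems on [nat] are exactly the indices of the power, so coordinate [F] of [z] can be the
   sequence that diverges along [F]. *)
pose z (n : nat) : power_two_continuum T := fun F => u F n.
have [|l zl] := countably_compact_cluster z _ T_cc.
  exact: hausdorff_product.
have [F [UF ooF zF]] := cluster_free_ultrafilter zl.
apply: (uP F UF ooF (l F)).
apply: cvg_trans (@proj_continuous _ (fun=> T) F l).
exact: cvg_app zF.
Qed.

Theorem mainTheorem4 (S : topologicalSemigroupType)
    (S_nonempty : [set: S] !=set0)
    (S_hausdorff : hausdorff_space S)
    (S_simple : simple_semigroup S)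
    (S_compactness : sequentially_compact_space S \/
      countably_compact_space (power_two_continuum S)) :
  topological_paragroup S.
Proof.
have [FF [FF_neq0 FF_free S_compact]] :
    exists FF, [/\ FF !=set0, free_filters FF & limit_compact FF S].
  case: S_compactness => [/sequentially_compact_limit_compact//|].
  exact: power_two_continuum_limit_compact.
have [e ee] :=
  exists_idempotent FF_neq0 FF_free S_hausdorff S_compact S_nonempty.
have /choice[inv invP] : forall s, exists t, local_submonoid e s ->
    [/\ local_submonoid e t, s * t = e & t * s = e].
  (* Outside eSe the value [s] is a mere default. *)
  move=> s; have [es|nes] := pselect (local_submonoid e s); last by exists s.
  have [t et [st ts]] :=
    local_group FF_neq0 FF_free S_hausdorff S_compact ee S_simple es.
  by exists t.
apply: (@local_topological_group_paragroup S e inv) => //.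
  split=> // a ea.
  exact: (local_inverse_continuous FF_neq0 FF_free S_hausdorff S_compact ee).
by move=> s; exact: simple_factor.
Qed.
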